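(* Let $1\le p<\infty$, let $\nu:\mathbb{R}^d\setminus\{0\}\to[0,\infty)$ be measurable and symmetric ($\nu(h)=\nu(-h)$) with $\nu\in L^1(\mathbb{R}^d\setminus B(0,r))$ for every $r>0$, and assume $\nu\not\equiv0$, i.e. $|\{\nu>0\}|>0$. Let $\Omega\subset\mathbb{R}^d$ be open and bounded in one direction: there exist $R>0$ and $e\in\mathbb{R}^d$, $|e|=1$, such that $\Omega\subset H_R$, where $H_R=\{z\in\mathbb{R}^d:|z\cdot e|\le R\}$. Then for all sufficiently large $m\in\mathbb{N}$ there is a constant $0<C_{R,m}=C(d,p,R,m,\nu)<\infty$ such that $$\|u\|^p_{L^p(\Omega)}\le C_{R,m}\,\mathcal{E}(u,u)\qquad\text{for all }u\in L^p_\Omega(\mathbb{R}^d).$$ Moreover, setting $q_0=q:=1\wedge\nu$ and $q_m=q_{m-1}*q_{m-1}$, one can choose $$C_{R,m}=2^{pm}\|q\|^{2^m-1}_{L^1(\mathbb{R}^d)}\Big(\int_{H_{2R}^c}q_m(h)\,dh\Big)^{-1}.$$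
   Context: $L^p_\Omega(\mathbb{R}^d)=\{u\in L^p(\mathbb{R}^d):u=0\text{ a.e. on }\Omega^c\}$, $\Omega^c=\mathbb{R}^d\setminus\Omega$, $H_{2R}^c=\mathbb{R}^d\setminus H_{2R}$ with $H_{2R}=\{z:|z\cdot e|\le2R\}$. The energy is $$\mathcal{E}(u,u)=\iint_{(\Omega^c\times\Omega^c)^c}|u(x)-u(y)|^p\nu(x-y)\,dy\,dx\in[0,\infty],$$ which for $u\in L^p_\Omega(\mathbb{R}^d)$ equals the integral over $\mathbb{R}^d\times\mathbb{R}^d$. $1\wedge\nu=\min(1,\nu)$ and $*$ is convolution on $\mathbb{R}^d$. *)

(* Defs.v *)
From HB Require Import structures.
From mathcomp Require Import all_boot all_order all_algebra.
From mathcomp Require Import all_classical all_reals all_analysis.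

Set Implicit Arguments.
Unset Strict Implicit.
Unset Printing Implicit Defensive.

Import Order.TTheory GRing.Theory Num.Theory.
Import numFieldNormedType.Exports.

Local Open Scope classical_set_scope.
Local Open Scope ring_scope.

(** R^d is ['rV[R]_d], with its library topology.  Its measurable sets are
    those of the product sigma-algebra (as the library does for [d.-tuple R]);
    R being second countable, these are the Borel sets of R^d. *)

Definition measure_rV_display : measure_display -> measure_display.
Proof. exact. Qed.

Section measurable_rV.
Context {R : realType} {d : nat}.

Let coor : 'I_d -> 'rV[R]_d -> R := fun i x => x ord0 i.

Let rV_set0 : g_sigma_preimage coor set0.
Proof. exact: sigma_algebra0. Qed.

Let rV_setC A : g_sigma_preimage coor A -> g_sigma_preimage coor (~` A).
Proof. exact: sigma_algebraC. Qed.

Let rV_bigcup (F : _^nat) : (forall i, g_sigma_preimage coor (F i)) ->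
  g_sigma_preimage coor (\bigcup_i (F i)).
Proof. exact: sigma_algebra_bigcup. Qed.

HB.instance Definition _ := @isMeasurable.Build
  (measure_rV_display default_measure_display)
  'rV[R]_d (g_sigma_preimage coor) rV_set0 rV_setC rV_bigcup.

Lemma measurable_coor (i : 'I_d) :
  measurable_fun [set: 'rV[R]_d] (fun x => x ord0 i).
Proof.
move=> _ Y mY; rewrite setTI; apply: sub_sigma_algebra => /=.
rewrite -bigcup_seq/=; exists i => /=; first by rewrite mem_index_enum.
by exists Y => //; rewrite setTI.
Qed.

Lemma measurable_fun_rVP d' (T : measurableType d') (f : T -> 'rV[R]_d) :
  (forall i, measurable_fun [set: T] (fun t => f t ord0 i)) ->
  measurable_fun [set: T] f.
Proof.
move=> mf _ A mA.
suff : g_sigma_preimage coor `<=` [set B | measurable (f @^-1` B)].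
  by move=> /(_ A mA); rewrite /= setTI.
apply: smallest_sub.
  split => /=.
  - by rewrite preimage_set0.
  - by move=> B mB; rewrite setTD preimage_setC; exact: measurableC.
  - by move=> F mF; rewrite preimage_bigcup; exact: bigcup_measurable.
rewrite -bigcup_seq => B [i _ [C mC <-]] /=.
by have := mf i measurableT _ mC; rewrite !setTI.
Qed.

End measurable_rV.

(** Lebesgue measure on R^d, by recursion on d: the image of
    (Lebesgue on R) x (Lebesgue on R^d) under the identification of
    R x R^d with R^(d+1); on R^0 it is the unit mass. *)

Section lebesgue_succ.
Context {R : realType} {d : nat}.
Variable mu : {sigma_finite_measure set 'rV[R]_d -> \bar R}.
Local Open Scope ereal_scope.

Definition cons_rV (z : R * 'rV[R]_d) : 'rV[R]_d.+1 :=
  row_mx (const_mx z.1 : 'rV[R]_1) z.2.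

Definition uncons_rV (v : 'rV[R]_d.+1) : R * 'rV[R]_d :=
  (v ord0 ord0, rsubmx (v : 'rV[R]_(1 + d))).

Lemma cons_rVK : cancel cons_rV uncons_rV.
Proof.
case=> a v; rewrite /cons_rV /uncons_rV /= row_mxKr; congr pair.
rewrite mxE; case: splitP => [i _|i]; first by rewrite mxE.
by move=> /eqP.
Qed.

Lemma measurable_cons_rV : measurable_fun setT cons_rV.
Proof.
apply: measurable_fun_rVP => i.
have E z : cons_rV z ord0 i = match @fintype.split 1 d i with
  | inl _ => z.1 | inr j => z.2 ord0 j end.
  by rewrite mxE; case: fintype.split => // j; rewrite mxE.
under eq_fun do rewrite E.
case: fintype.split => j; first exact: measurable_fst.
exact: (measurableT_comp (measurable_coor j) measurable_snd).
Qed.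

Lemma measurable_uncons_rV : measurable_fun setT uncons_rV.
Proof.
apply/measurable_fun_pairP; split; first exact: measurable_coor.
apply: measurable_fun_rVP => i /=.
by under eq_fun do rewrite mxE; exact: measurable_coor.
Qed.

Definition lebesgue_succ : set 'rV[R]_d.+1 -> \bar R :=
  pushforward (@lebesgue_measure R \x mu) cons_rV.

Let lebesgue_succ0 : lebesgue_succ set0 = 0.
Proof. by rewrite /lebesgue_succ /pushforward preimage_set0 measure0. Qed.

Let lebesgue_succ_ge0 A : 0 <= lebesgue_succ A.
Proof.
exact: (measure_ge0 ((@lebesgue_measure R \x mu) : {measure set _ -> \bar R})).
Qed.

Let lebesgue_succ_sigma_additive : semi_sigma_additive lebesgue_succ.
Proof.
have mP A : measurable A -> measurable (cons_rV @^-1` A).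
  by move=> mA; rewrite -[X in measurable X]setTI; exact: measurable_cons_rV.
move=> F mF tF mUF; rewrite /lebesgue_succ /pushforward preimage_bigcup.
apply: measure_semi_sigma_additive.
- by move=> n; exact: mP.
- apply/trivIsetP => /= i j _ _ ij; rewrite -preimage_setI.
  by move/trivIsetP : tF => /(_ _ _ _ _ ij) ->//; rewrite preimage_set0.
- by rewrite -preimage_bigcup; exact: mP.
Qed.

HB.instance Definition _ := isMeasure.Build _ _ _ lebesgue_succ
  lebesgue_succ0 lebesgue_succ_ge0 lebesgue_succ_sigma_additive.

Let lebesgue_succ_sigma_finite : sigma_finite setT lebesgue_succ.
Proof.
have /sigma_finiteP[F [TF ndF Foo]] := sigma_finiteT (@lebesgue_measure R).
have /sigma_finiteP[G [TG ndG Goo]] := sigma_finiteT mu.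
exists (fun n => uncons_rV @^-1` (F n `*` G n)).
  apply/esym; rewrite -subTset => v _.
  have [n _ Fn] : (\bigcup_n F n) (uncons_rV v).1 by rewrite -TF.
  have [k _ Gk] : (\bigcup_n G n) (uncons_rV v).2 by rewrite -TG.
  exists (maxn n k) => //; split => /=.
    by move: Fn; exact/subsetPset/ndF/leq_maxl.
  by move: Gk; exact/subsetPset/ndG/leq_maxr.
move=> n; have [mF Fn] := Foo n; have [mG Gn] := Goo n.
have mFG : measurable (F n `*` G n) by exact: measurableX.
split.
  by rewrite -[X in measurable X]setTI; exact: measurable_uncons_rV.
rewrite /lebesgue_succ /pushforward -comp_preimage.
have -> : uncons_rV \o cons_rV = id by apply/funext => z /=; rewrite cons_rVK.
by rewrite preimage_id product_measure1E// lte_mul_pinfty// ge0_fin_numE.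
Qed.

HB.instance Definition _ := Measure_isSigmaFinite.Build _ _ _ lebesgue_succ
  lebesgue_succ_sigma_finite.

End lebesgue_succ.

Fixpoint lebesgue_rV (R : realType) (d : nat) :
    {sigma_finite_measure set 'rV[R]_d -> \bar R} :=
  match d with
  | 0 => (\d_ (0 : 'rV[R]_0)) : {sigma_finite_measure set _ -> \bar R}
  | d'.+1 => lebesgue_succ (lebesgue_rV R d')
  end.

(** The normalization that characterizes Lebesgue measure. *)

Definition box (R : realType) d (a b : 'rV[R]_d) : set 'rV[R]_d :=
  [set x | forall i, a ord0 i <= x ord0 i <= b ord0 i].

Lemma measurable_box (R : realType) d (a b : 'rV[R]_d) : measurable (box a b).
Proof.
rewrite (_ : box a b = \bigcap_(i in [set: 'I_d])
   ((fun x : 'rV[R]_d => x ord0 i) @^-1` `[a ord0 i, b ord0 i])); last first.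
  by apply/seteqP; split => x /= H i => [_|]; have := H i; rewrite /= in_itv/=; apply.
apply: fin_bigcap_measurable => // i _.
rewrite -[X in measurable X]setTI; apply: measurable_coor => //.
Qed.

Lemma lebesgue_rV_box (R : realType) (d : nat) (a b : 'rV[R]_d) :
  (forall i, a ord0 i <= b ord0 i) ->
  lebesgue_rV R d (box a b) = (\prod_(i < d) (b ord0 i - a ord0 i))%:E.
Proof.
elim: d a b => [|d IH] a b ab.
  rewrite big_ord0 /= diracE mem_set//=; by case.
rewrite /= /lebesgue_succ /pushforward.
have -> : cons_rV @^-1` box a b =
  `[a ord0 ord0, b ord0 ord0] `*` box (rsubmx (a : 'rV_(1+d))) (rsubmx (b : 'rV_(1+d))).
  have c0 (z : R * 'rV[R]_d) : cons_rV z ord0 ord0 = z.1 :> R.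
    by have := congr1 fst (@cons_rVK R d z).
  have c1 (z : R * 'rV[R]_d) i : cons_rV z ord0 (lift ord0 i) = z.2 ord0 i.
    have := congr1 snd (@cons_rVK R d z) => /= /rowP/(_ i) <-.
    rewrite [RHS]mxE; congr ((_ : _ -> _ -> R) _ _); exact/val_inj.
  have s (v : 'rV[R]_d.+1) i : rsubmx (v : 'rV_(1+d)) ord0 i = v ord0 (lift ord0 i).
    by rewrite mxE; congr (v _ _); apply/val_inj.
  apply/seteqP; split => z /=.
    move=> H; split; first by have := H ord0; rewrite c0 in_itv.
    by move=> i; rewrite !s -c1; exact: H.
  move=> -[+ H2] i; rewrite in_itv /= => H1.
  case: (unliftP ord0 i) => [j ->|->]; last by rewrite c0.
  by have := H2 j; rewrite !s c1.
rewrite product_measure1E//; last exact: measurable_box.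
have sb (v : 'rV[R]_d.+1) i : rsubmx (v : 'rV_(1+d)) ord0 i = v ord0 (lift ord0 i).
  by rewrite mxE; congr (v _ _); apply/val_inj.
rewrite IH; last by move=> i; rewrite !sb.
rewrite big_ord_recl EFinM; congr (_ * _)%E.
  apply: (eq_trans (lebesgue_measure_itv `[a ord0 ord0, b ord0 ord0])).
  rewrite /= lte_fin.
  have := ab ord0; rewrite le_eqVlt => /orP[/eqP ->|->].
    by rewrite ltxx subrr.
  by rewrite EFinB.
by congr EFin; apply: eq_bigr => i _; rewrite !sb.
Qed.

Section euclidean.
Context {R : realType} {d : nat}.
Implicit Types x y e z : 'rV[R]_d.

Definition dotp x y : R := \sum_(i < d) x ord0 i * y ord0 i.

(** The library norm on ['rV[R]_d] is the sup norm, hence this one. *)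
Definition enorm x : R := Num.sqrt (dotp x x).

Definition eball (r : R) : set 'rV[R]_d := [set x | enorm x < r].

Definition slab e (r : R) : set 'rV[R]_d := [set z | `|dotp z e| <= r].

End euclidean.

Section function_spaces.
Context {R : realType} {d : nat}.
Implicit Types (f u nu : 'rV[R]_d -> R) (A Omega : set 'rV[R]_d) (p : R).

Local Notation leb := (lebesgue_rV R d).

(** Measurability for the completion of Lebesgue measure.  The integral of the
    library is a supremum over simple functions below the (positive and
    negative parts of the) integrand and ignores null sets, so it gives the
    Lebesgue integral of such functions as well. *)
Definition lebesgue_measurable f : Prop :=
  exists2 g : 'rV[R]_d -> R,
    measurable_fun [set: 'rV[R]_d] g & {ae leb, forall x, f x = g x}.

Definition Lp_norm p A f : \bar R := ('N[leb]_(p%:E)[EFin \o (f \_ A)])%E.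

Definition in_Lp p A f : Prop :=
  lebesgue_measurable (f \_ A) /\ (Lp_norm p A f < +oo)%E.

Definition in_Lp_Omega p Omega u : Prop :=
  in_Lp p setT u /\ {ae leb, forall x, (~` Omega) x -> u x = 0}.

Definition energy p nu Omega u : \bar R :=
  (\int[leb \x leb]_(z in ~` (~` Omega `*` ~` Omega))
     (`|u z.1 - u z.2| `^ p * nu (z.1 - z.2))%:E)%E.

Definition convolution (f g : 'rV[R]_d -> \bar R) (x : 'rV[R]_d) : \bar R :=
  (\int[leb]_y (f (x - y)%R * g y))%E.

Fixpoint qiter nu (m : nat) : 'rV[R]_d -> \bar R :=
  match m with
  | 0 => fun h => (Num.min 1 (nu h))%:E
  | m'.+1 => convolution (qiter nu m') (qiter nu m')
  end.

End function_spaces.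

(* Main.v *)
Require Import Defs.
From HB Require Import structures.
From mathcomp Require Import all_boot all_order all_algebra.
From mathcomp Require Import all_classical all_reals all_analysis.
From mathcomp Require Import measurable_realfun ring lra.

Import Order.TTheory GRing.Theory Num.Theory.
Import numFieldNormedType.Exports.
Import HBNNSimple.

Local Open Scope classical_set_scope.
Local Open Scope ring_scope.

(** The energy is an average of [L^p] increments.  With
    Phi_u(h) = int |u(x) - u(x - h)|^p dx, Tonelli gives
    E(u,u) = int nu Phi_u >= int q Phi_u for q = min(1, nu).
    By convexity of t |-> |t|^p and translation invariance, Phi_u is
    subadditive up to the factor 2^(p-1), and since
    int (q * q) Phi = int int q(x) q(y) Phi(x + y) dx dy, replacing q by q * q
    multiplies the weighted average of Phi_u by at most 2^p |q|_1.  After m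
    steps int q_m Phi_u <= 2^(pm) |q|_1^(2^m - 1) E(u,u) ([qiter_subadditive]).

    Conversely, if u lives in the slab H_R and h is outside H_2R, then x and
    x - h are never both in H_R, so that Phi_u(h) >= |u|_p^p; hence
    |u|_p^p times the mass of q_m outside H_2R is at most int q_m Phi_u
    ([mass_far_le]).

    It remains to see that q_m charges the complement of H_2R for m large
    ([qiter_far_gt0]).  Instead of following the supports of the q_m, one looks
    at the second moment of q_m in the direction e.  The weight
    w(h) = (h.e)^2 satisfies the parallelogram law and q is even, so the same
    formula for int (q * q) w shows that the second moment of q_m is exactly
    2^m |q|_1^(2^m - 1) times that of q, which is positive because hyperplanes
    are null.  Since q_m has mass |q|_1^(2^m), it would be at most
    (2R)^2 |q|_1^(2^m) if q_m vanished outside H_2R: impossible once 2^m is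
    large.

    All of this is done for an even nonnegative Borel kernel; a kernel that is
    only measurable for the completed measure is replaced by such a
    representative ([even_borel_representative]), which changes neither the
    integrals nor, up to null sets, the iterated convolutions. *)

(** * Integrals of functions that are measurable up to a null set *)

Section ae_integral.
Local Open Scope ereal_scope.

(** The integral is a supremum over simple functions below the integrand, and
    cutting such a function off on a null set does not change its integral.
    The comparison thus covers integrands built from arbitrary representatives
    of [nu] and [u], which are measurable only up to a null set. *)
Lemma ge0_le_integral_ae disp (T : measurableType disp) (R : realType)
    (mu : {measure set T -> \bar R}) (f g : T -> \bar R) :
  (forall x, 0 <= f x) -> (forall x, 0 <= g x) ->
  {ae mu, forall x, f x <= g x} -> \int[mu]_x f x <= \int[mu]_x g x.
Proof.
move=> f0 g0 [N [mN N0 fgN]]; rewrite !ge0_integralTE//.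
apply: ge_ereal_sup => _ [h /= hf <-]; apply: le_ereal_sup_tmp.
have mNC : measurable (~` N) by exact: measurableC.
exists (sintegral mu (proj_nnsfun h mNC)).
  exists (proj_nnsfun h mNC) => //= x; rewrite /= mindicE.
  have [|_] := boolP (x \in ~` N); last by rewrite mulr0.
  rewrite inE mulr1 => Nx; apply: le_trans (hf x) _.
  by apply: contrapT => fg; apply/Nx/fgN.
rewrite -!integralT_nnsfun le_eqVlt; apply/orP; left; apply/eqP.
apply: ae_eq_integral => //; [exact/measurable_EFinP|exact/measurable_EFinP|].
exists N; split=> // x /= hx; apply: contrapT => Nx; apply: hx => _.
by rewrite /= mindicE mem_set// mulr1.
Qed.

Lemma eq_integral_ae disp (T : measurableType disp) (R : realType)
    (mu : {measure set T -> \bar R}) (f g : T -> \bar R) :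
  {ae mu, forall x, f x = g x} -> \int[mu]_x f x = \int[mu]_x g x.
Proof.
move=> fg; rewrite integralE [RHS]integralE; congr (_ - _);
  apply/eqP; rewrite eq_le; apply/andP; split;
  apply: ge0_le_integral_ae => //;
  by apply: filterS fg => x; rewrite ?funeposE ?funenegE => ->.
Qed.

End ae_integral.

(** * Invariance of Lebesgue measure under reflections and translations *)

Section reflectionR.
Local Open Scope ereal_scope.
Context {R : realType}.
Local Notation leb := (@lebesgue_measure R).
Local Notation RT := (measurableTypeR R).

Lemma ge0_integral_reflectR (a : R) (f : RT -> \bar R) :
  measurable_fun setT f -> (forall x, 0 <= f x) ->
  \int[leb]_x f (a - x)%R = \int[leb]_x f x.
Proof.
move=> mf f0.
have mr : measurable_fun setT ((fun x : R => (a - x)%R) : RT -> RT).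
  exact: measurable_funB.
have := @ge0_integral_pushforward _ _ RT RT R _ mr leb setT f measurableT mf
  (fun x _ => f0 x).
rewrite preimage_setT => <-.
apply: eq_measure_integral => A mA _; apply/esym.
have mr' := isMeasurableFun.Build _ _ _ _ _ mr.
pose r : {mfun RT >-> RT} := HB.pack ((fun x : R => (a - x)%R) : RT -> RT) mr'.
apply: (@lebesgue_measure_unique R (pushforward leb r)) => // X [[x y] _ <-].
rewrite /= /pushforward.
have -> : r @^-1` `]x, y] = `[(a - y)%R, (a - x)%R[%classic.
  by apply/seteqP; split => t /=; rewrite !in_itv/=; lra.
rewrite !lebesgue_measure_itv/= !lte_fin.
by rewrite ltrD2l ltrN2 -!EFinB; case: ifP => // _; congr EFin; ring.
Qed.

End reflectionR.

Section vector_measurability.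
Context {R : realType} {d : nat} disp (T : measurableType disp).
Implicit Types f g : T -> 'rV[R]_d.

Lemma measurable_rVD f g : measurable_fun setT f -> measurable_fun setT g ->
  measurable_fun setT (fun t => f t + g t)%R.
Proof.
move=> mf mg; apply: measurable_fun_rVP => i.
under eq_fun do rewrite mxE.
by apply: measurable_funD; exact: (measurableT_comp (measurable_coor i)).
Qed.

Lemma measurable_rVN f : measurable_fun setT f ->
  measurable_fun setT (fun t => - f t)%R.
Proof.
move=> mf; apply: measurable_fun_rVP => i.
under eq_fun do rewrite mxE.
by apply: measurableT_comp => //; exact: (measurableT_comp (measurable_coor i)).
Qed.

Lemma measurable_rVB f g : measurable_fun setT f -> measurable_fun setT g ->
  measurable_fun setT (fun t => f t - g t)%R.
Proof. by move=> mf mg; apply: measurable_rVD => //; exact: measurable_rVN. Qed.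

End vector_measurability.

Section reflection.
Local Open Scope ereal_scope.
Context {R : realType}.

Lemma ge0_integral_lebesgue_rVS (d : nat) (f : 'rV[R]_d.+1 -> \bar R) :
  measurable_fun setT f -> (forall x, 0 <= f x) ->
  \int[lebesgue_rV R d.+1]_x f x =
  \int[@lebesgue_measure R]_t \int[lebesgue_rV R d]_v f (cons_rV (t, v)).
Proof.
move=> mf f0; rewrite /= /lebesgue_succ.
rewrite ge0_integral_pushforward//; last exact: measurable_cons_rV.
rewrite preimage_setT.
apply: (@fubini_tonelli1 _ _ (measurableTypeR R) _ R _ _
  (f \o (@cons_rV R d) : measurableTypeR R * 'rV[R]_d -> \bar R)) => //.
  by apply: measurableT_comp => //; exact: measurable_cons_rV.
by move=> x; exact: f0.
Qed.

(** Reflections suffice, a translation being the composite of two of them; by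
    Tonelli the claim reduces to the coordinates one at a time. *)
Lemma ge0_integral_reflect (d : nat) (a : 'rV[R]_d) (f : 'rV[R]_d -> \bar R) :
  measurable_fun setT f -> (forall x, 0 <= f x) ->
  \int[lebesgue_rV R d]_x f (a - x)%R = \int[lebesgue_rV R d]_x f x.
Proof.
elim: d a f => [|d IH] a f mf f0.
  by apply: eq_integral => x _; rewrite [(a - x)%R]thinmx0 [x]thinmx0.
have mfr : measurable_fun setT (fun x : 'rV[R]_d.+1 => f (a - x)%R).
  by apply: measurableT_comp => //; exact: measurable_rVB.
rewrite !ge0_integral_lebesgue_rVS//.
have E t v : (a - cons_rV (t, v))%R =
  cons_rV ((uncons_rV a).1 - t, (uncons_rV a).2 - v)%R.
  apply/rowP => i; rewrite /cons_rV /= !mxE; case: splitP => j ij.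
    by rewrite !mxE; congr (a _ _ - _)%R; apply: val_inj; rewrite /= ij ord1.
  by rewrite !mxE; congr (a _ _ - _)%R; apply: val_inj.
under eq_integral => t _ do under eq_integral => v _ do rewrite E.
have mc : measurable_fun setT (f \o @cons_rV R d).
  by apply: measurableT_comp => //; exact: measurable_cons_rV.
transitivity (\int[@lebesgue_measure R]_t \int[lebesgue_rV R d]_v
    f (cons_rV ((uncons_rV a).1 - t, v))%R).
  apply: eq_integral => t _.
  apply: (IH _ (fun v => f (cons_rV ((uncons_rV a).1 - t, v))%R)) => //.
  apply: (measurableT_comp mc); exact: pair1_measurable.
apply: (@ge0_integral_reflectR R _
  (fun t => \int[lebesgue_rV R d]_v f (cons_rV (t, v)))).
  apply: (@measurable_fun_fubini_tonelli_F _ _ (measurableTypeR R) _ R _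
    (f \o @cons_rV R d : measurableTypeR R * 'rV[R]_d -> \bar R)) => //.
  by move=> z; exact: f0.
by move=> t; apply: integral_ge0 => v _; exact: f0.
Qed.

Lemma ge0_integral_translate (d : nat) (a : 'rV[R]_d) (f : 'rV[R]_d -> \bar R) :
  measurable_fun setT f -> (forall x, 0 <= f x) ->
  \int[lebesgue_rV R d]_x f (x + a)%R = \int[lebesgue_rV R d]_x f x.
Proof.
move=> mf f0.
rewrite -[RHS](ge0_integral_reflect _ a)//.
rewrite -[RHS](ge0_integral_reflect _ 0 (fun x => f (a - x)%R))//.
- by apply: eq_integral => x _; rewrite sub0r opprK addrC.
- by apply: (measurableT_comp mf); exact: measurable_rVB.
Qed.

End reflection.

(** * Null sets *)

Section null_sets.
Local Open Scope ereal_scope.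
Context {R : realType} {d : nat}.
Local Notation leb := (lebesgue_rV R d).
Local Notation V := 'rV[R]_d.

Lemma lebesgue_rV_reflect (a : V) (A : set V) : measurable A ->
  leb [set x | A (a - x)%R] = leb A.
Proof.
move=> mA.
have mr : measurable_fun setT (fun x : V => (a - x)%R) by exact: measurable_rVB.
have intE B : measurable B -> \int[leb]_x (\1_B x)%:E = leb B.
  by move=> mB; rewrite integral_indic// setIT.
rewrite -!intE//; last by rewrite -[X in measurable X]setTI; exact: mr.
rewrite -(ge0_integral_reflect _ a (EFin \o \1_A))//.
  exact/measurable_EFinP.
by move=> x; rewrite lee_fin.
Qed.

Lemma ae_reflect (a : V) (P : V -> Prop) :
  {ae leb, forall x, P x} -> {ae leb, forall x, P (a - x)%R}.
Proof.
move=> [N [mN N0 PN]]; exists [set x | N (a - x)%R]; split.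
- rewrite -[X in measurable X]setTI.
  have mr : measurable_fun setT (fun x : V => (a - x)%R) by exact: measurable_rVB.
  exact: mr.
- by rewrite lebesgue_rV_reflect.
- by move=> x /= nP; exact: PN.
Qed.

Lemma ae_translate (a : V) (P : V -> Prop) :
  {ae leb, forall x, P x} -> {ae leb, forall x, P (x - a)%R}.
Proof.
move=> /(ae_reflect (- a)%R) /(ae_reflect 0%R).
by apply: filterS => x; rewrite sub0r opprK addrC.
Qed.

Lemma ae_opp (P : V -> Prop) :
  {ae leb, forall x, P x} -> {ae leb, forall x, P (- x)%R}.
Proof. by move=> /(ae_reflect 0%R); apply: filterS => x; rewrite sub0r. Qed.

Lemma ae_prod_fst (P : V -> Prop) :
  {ae leb, forall x, P x} -> {ae leb \x leb, forall z, P z.1}.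
Proof.
move=> [N [mN N0 PN]]; exists (N `*` setT); split.
- exact: measurableX.
- by apply: (eq_trans (product_measure1E _ _ mN measurableT)); rewrite [X in X * _]N0 mul0e.
- by move=> x /= nP; split=> //; exact: PN.
Qed.

Lemma ae_prod_snd (P : V -> Prop) :
  {ae leb, forall x, P x} -> {ae leb \x leb, forall z, P z.2}.
Proof.
move=> [N [mN N0 PN]]; exists (setT `*` N); split.
- exact: measurableX.
- by apply: (eq_trans (product_measure1E _ _ measurableT mN)); rewrite [X in _ * X]N0 mule0.
- by move=> x /= nP; split=> //; exact: PN.
Qed.

(** Every section of the set where [P (x - y)] fails is the reflection of a
    null set. *)
Lemma ae_prod_sub (P : V -> Prop) :
  {ae leb, forall x, P x} -> {ae leb \x leb, forall z, P (z.1 - z.2)%R}.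
Proof.
move=> [N [mN N0 PN]]; exists [set z | N (z.1 - z.2)%R]; split.
- rewrite -[X in measurable X]setTI.
  have ms : measurable_fun setT (fun z : V * V => (z.1 - z.2)%R).
    exact: measurable_rVB.
  exact: ms.
- rewrite [LHS]/product_measure1 integral0_eq// => x _ /=.
  rewrite [X in leb X](_ : _ = [set y | N (x - y)%R]).
    exact: (etrans (lebesgue_rV_reflect x _ mN) N0).
  by rewrite /xsection; apply/seteqP; split => y /=; rewrite inE.
- by move=> x /= nP; exact: PN.
Qed.

Lemma dotpDl (x y e : V) : dotp (x + y) e = (dotp x e + dotp y e)%R.
Proof.
by rewrite /dotp -big_split/=; apply: eq_bigr => i _; rewrite mxE mulrDl.
Qed.

Lemma dotpZl (t : R) (x e : V) : dotp (t *: x) e = (t * dotp x e)%R.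
Proof.
by rewrite /dotp mulr_sumr; apply: eq_bigr => i _; rewrite mxE mulrA.
Qed.

Lemma dotpNl (x e : V) : dotp (- x) e = (- dotp x e)%R.
Proof. by rewrite -scaleN1r dotpZl mulN1r. Qed.

Lemma measurable_dotp (e : V) : measurable_fun setT (fun x : V => dotp x e).
Proof.
apply: measurable_sum => i; apply: measurable_funM => //.
exact: measurable_coor.
Qed.

Lemma measurable_hyperplane (e : V) : measurable [set x | dotp x e = 0%R].
Proof.
rewrite -[X in measurable X]setTI.
exact: (measurable_dotp e measurableT _ (measurable_set1 0%R)).
Qed.

Lemma measurable_slab (e : V) (L : R) : measurable (slab e L).
Proof.
rewrite -[X in measurable X]setTI.
have mf : measurable_fun setT (fun x : V => `|dotp x e|)%R.
  by apply: measurableT_comp => //; exact: measurable_dotp.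
rewrite (_ : slab _ _ = (fun x : V => `|dotp x e|)%R @^-1` `]-oo, L]).
  exact: mf.
by apply/seteqP; split => x; rewrite /slab /= in_itv.
Qed.

(** The parallel hyperplanes [dotp x e = t] all have the same measure, by
    translation along [e].  Tonelli applied to the set of pairs [(t, x)] with
    [dotp x e = t] gives, in one order, this measure integrated over the whole
    real line and, in the other order, the integral of the length of a point,
    that is 0. *)
Lemma hyperplane_null (e : V) : dotp e e = 1%R ->
  leb [set x | dotp x e = 0%R] = 0.
Proof.
move=> ee.
have mh : measurable_fun setT (fun x : V => dotp x e) by exact: measurable_dotp.
set H := [set x | dotp x e = 0%R].
have mH : measurable H by exact: measurable_hyperplane.
pose S := [set z : measurableTypeR R * V | dotp z.2 e = z.1].
have mS : measurable S.
  have ms : measurable_fun setT (fun z : measurableTypeR R * V => dotp z.2 e - z.1)%R.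
    apply: measurable_funB; last exact: measurable_fst.
    exact: (measurableT_comp mh).
  rewrite (_ : S = setT `&` (fun z => dotp z.2 e - z.1)%R @^-1` [set 0%R]).
    exact: (ms measurableT _ (measurable_set1 0%R)).
  rewrite setTI; apply/seteqP; split => z /=.
    by rewrite /S/= => ->; rewrite subrr.
  by move=> /eqP; rewrite subr_eq0 => /eqP.
have mS' : measurable_fun setT (EFin \o (\1_S : _ -> R)).
  exact/measurable_EFinP.
have := @fubini_tonelli _ _ (measurableTypeR R) V R (@lebesgue_measure R) leb
  (EFin \o \1_S) mS'.
have S0 z : 0 <= (EFin \o (\1_S : _ -> R)) z by rewrite lee_fin.
move=> /(_ S0).
have intE (B : set V) : measurable B -> \int[leb]_x (\1_B x)%:E = leb B.
  by move=> mB; rewrite integral_indic// setIT.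
have L (t : R) : \int[leb]_x (EFin \o (\1_S : _ -> R)) (t, x) = leb H.
  rewrite -intE// -(ge0_integral_translate _ (- (t *: e))%R (EFin \o \1_H)).
  - apply: eq_integral => x _ /=; congr EFin; rewrite !indicE; congr (_ : bool)%:R.
    apply/idP/idP; rewrite !inE /S /H /= dotpDl dotpNl dotpZl ee mulr1.
      by move=> ->; rewrite subrr.
    by move=> /eqP; rewrite subr_eq0 => /eqP.
  - exact/measurable_EFinP.
  - by move=> x; rewrite lee_fin.
have Z (x : V) :
    \int[@lebesgue_measure R]_t (EFin \o (\1_S : _ -> R)) (t, x) = 0.
  rewrite -[RHS](@lebesgue_measure_set1 R (dotp x e)).
  rewrite -[in RHS](setIT [set dotp x e]) -integral_indic//.
  apply: eq_integral => t _ /=; congr EFin; rewrite !indicE; congr (_ : bool)%:R.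
  by apply/idP/idP; rewrite !inE /S /=.
under eq_integral => t _ do rewrite L.
under [RHS]eq_integral => x _ do rewrite Z.
rewrite integral0 integral_cst// => /eqP; rewrite mule_eq0 => /orP[/eqP //|].
rewrite [X in X == _](_ : _ = +oo)//.
by rewrite -set_itvNyy; apply: etrans (lebesgue_measure_itv _) _.
Qed.

Lemma ae_dotp_neq0 (e : V) : dotp e e = 1%R ->
  {ae leb, forall x, dotp x e != 0%R}.
Proof.
move=> ee; exists [set x | dotp x e = 0%R]; split.
- exact: measurable_hyperplane.
- exact: hyperplane_null.
- by move=> x /= /negP; rewrite negbK => /eqP.
Qed.

Lemma ae_neq0 (e : V) : dotp e e = 1%R -> {ae leb, forall h, h != 0%R}.
Proof.
move=> /ae_dotp_neq0; apply: filterS => x; apply: contra => /eqP ->.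
by rewrite -(scale0r 0%R) dotpZl mul0r.
Qed.

End null_sets.

(** * Integrals against a convolution *)

Section convolution.
Local Open Scope ereal_scope.
Context {R : realType} {d : nat}.
Local Notation leb := (lebesgue_rV R d).
Local Notation V := 'rV[R]_d.
Implicit Types f g Phi : V -> \bar R.

Lemma convolution_ge0 f g : (forall x, 0 <= f x) -> (forall x, 0 <= g x) ->
  forall x, 0 <= convolution f g x.
Proof. by move=> f0 g0 x; apply: integral_ge0 => y _; exact: mule_ge0. Qed.

Lemma measurable_convolution f g :
  measurable_fun setT f -> measurable_fun setT g ->
  (forall x, 0 <= f x) -> (forall x, 0 <= g x) ->
  measurable_fun setT (convolution f g).
Proof.
move=> mf mg f0 g0.
apply: (measurable_fun_fubini_tonelli_F
  (fun z : V * V => f (z.1 - z.2)%R * g z.2)).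
  apply: emeasurable_funM.
    by apply: measurableT_comp => //; exact: measurable_rVB.
  by apply: measurableT_comp.
by move=> z; exact: mule_ge0.
Qed.

(** The right-hand side is the integral of [f(x) g(y) Phi(x + y)]: in the
    probabilistic reading, the law of a sum of independent variables. *)
Lemma integral_convolution f g Phi :
  measurable_fun setT f -> measurable_fun setT g -> measurable_fun setT Phi ->
  (forall x, 0 <= f x) -> (forall x, 0 <= g x) -> (forall x, 0 <= Phi x) ->
  \int[leb]_x (convolution f g x * Phi x) =
  \int[leb]_y (g y * \int[leb]_x (f x * Phi (x + y)%R)).
Proof.
move=> mf mg mP f0 g0 P0.
have mfB y : measurable_fun setT (fun x : V => f (x - y)%R).
  by apply: measurableT_comp => //; exact: measurable_rVB.
have mfB' x : measurable_fun setT (fun y : V => f (x - y)%R).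
  by apply: measurableT_comp => //; exact: measurable_rVB.
transitivity (\int[leb]_x \int[leb]_y (f (x - y)%R * g y * Phi x)).
  apply: eq_integral => x _; rewrite -ge0_integralZr//.
  - exact: emeasurable_funM.
  - by move=> y _; exact: mule_ge0.
rewrite (fubini_tonelli (fun z : V * V => f (z.1 - z.2)%R * g z.2 * Phi z.1));
  last 2 first.
- apply: emeasurable_funM; last exact: measurableT_comp.
  apply: emeasurable_funM; last exact: measurableT_comp.
  by apply: measurableT_comp => //; exact: measurable_rVB.
- by move=> z; rewrite !mule_ge0.
apply: eq_integral => y _ /=.
under eq_integral => x _ do rewrite (muleC _ (g y)) -muleA.
rewrite ge0_integralZl//; last 2 first.
- exact: emeasurable_funM.
- by move=> x _; exact: mule_ge0.
congr (_ * _).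
rewrite -(ge0_integral_translate _ y (fun x => f (x - y)%R * Phi x)); last 2 first.
- exact: emeasurable_funM.
- by move=> x; exact: mule_ge0.
by apply: eq_integral => x _; rewrite addrK.
Qed.

Lemma convolution_mass f g :
  measurable_fun setT f -> measurable_fun setT g ->
  (forall x, 0 <= f x) -> (forall x, 0 <= g x) ->
  \int[leb]_x convolution f g x = \int[leb]_x f x * \int[leb]_x g x.
Proof.
move=> mf mg f0 g0; have := @integral_convolution f g (cst 1) mf mg.
under eq_integral do rewrite mule1.
move=> ->//; under [in LHS]eq_integral => y _.
  under eq_integral => x _ do rewrite mule1.
over.
rewrite /= ge0_integralZr//; first by rewrite muleC.
exact: integral_ge0.
Qed.

Lemma convolution_even f : measurable_fun setT f -> (forall x, 0 <= f x) ->
  (forall x, f (- x)%R = f x) ->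
  forall x, convolution f f (- x)%R = convolution f f x.
Proof.
move=> mf f0 fN x; rewrite /convolution.
have mfB : measurable_fun setT (fun y : V => f (- x - y)%R).
  by apply: measurableT_comp => //; exact: measurable_rVB.
rewrite -(ge0_integral_reflect _ 0 (fun y => f (- x - y)%R * f y)).
- by apply: eq_integral => y _; rewrite sub0r fN -opprD fN.
- exact: emeasurable_funM.
- by move=> y; exact: mule_ge0.
Qed.

(** Bound [Phi(x + y)] under the double integral; each of the two terms
    contributes the product of the mass of [f] and of [int f Phi], whence the
    factor 2. *)
Lemma integral_convolution_subadditive f Phi (K : R) : (0 <= K)%R ->
  measurable_fun setT f -> measurable_fun setT Phi ->
  (forall x, 0 <= f x) -> (forall x, 0 <= Phi x) ->
  (forall x y, Phi (x + y)%R <= K%:E * (Phi x + Phi y)) ->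
  \int[leb]_x (convolution f f x * Phi x) <=
  (2 * K)%:E * (\int[leb]_x f x * \int[leb]_x (f x * Phi x)).
Proof.
move=> K0 mf mP f0 P0 PD; rewrite integral_convolution//.
set N := \int[leb]_x f x; set M := \int[leb]_x (f x * Phi x).
have N0 : 0 <= N by exact: integral_ge0.
have M0 : 0 <= M by apply: integral_ge0 => x _; exact: mule_ge0.
have mfP : measurable_fun setT (fun x : V => f x * Phi x) by exact: emeasurable_funM.
have fP0 x : 0 <= f x * Phi x by exact: mule_ge0.
have mPD y : measurable_fun setT (fun x : V => Phi (x + y)%R).
  by apply: measurableT_comp => //; exact: measurable_rVD.
have mfi : measurable_fun setT (fun y : V => \int[leb]_x (f x * Phi (x + y)%R)).
  apply: (measurable_fun_fubini_tonelli_F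
    (fun z : V * V => f z.2 * Phi (z.2 + z.1)%R)).
    apply: emeasurable_funM; first exact: measurableT_comp.
    by apply: measurableT_comp => //; exact: measurable_rVD.
  by move=> z; exact: mule_ge0.
have H y : \int[leb]_x (f x * Phi (x + y)%R) <= K%:E * (M + N * Phi y).
  apply: (@le_trans _ _ (\int[leb]_x (K%:E * (f x * Phi x + f x * Phi y)))).
    apply: ge0_le_integral => //.
    - by move=> x _; exact: mule_ge0.
    - exact: emeasurable_funM.
    - apply: emeasurable_funM => //; apply: emeasurable_funD => //.
      exact: emeasurable_funM.
    - move=> x _; rewrite -ge0_muleDr// muleCA.
      by apply: lee_wpmul2l.
  rewrite ge0_integralZl//; last 2 first.
  - by apply: emeasurable_funD => //; exact: emeasurable_funM.
  - by move=> x _; rewrite adde_ge0// mule_ge0.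
  rewrite ge0_integralD//; last 2 first.
  - by move=> x _; exact: mule_ge0.
  - exact: emeasurable_funM.
  by rewrite ge0_integralZr.
apply: (@le_trans _ _ (\int[leb]_y (K%:E * (f y * M + N * (f y * Phi y))))).
  apply: ge0_le_integral => //.
  - by move=> y _; rewrite mule_ge0// integral_ge0// => x _; exact: mule_ge0.
  - exact: emeasurable_funM.
  - apply: emeasurable_funM => //; apply: emeasurable_funD => //.
      exact: emeasurable_funM.
    exact: emeasurable_funM.
  - move=> y _; apply: (le_trans (lee_wpmul2l (f0 y) (H y))).
    rewrite muleCA ge0_muleDr//; last exact: mule_ge0.
    by rewrite (muleCA (f y) N).
rewrite ge0_integralZl//; last 2 first.
- by apply: emeasurable_funD; exact: emeasurable_funM.
- by move=> y _; rewrite adde_ge0// !mule_ge0.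
rewrite ge0_integralD//; last 4 first.
- by move=> y _; exact: mule_ge0.
- exact: emeasurable_funM.
- by move=> y _; rewrite mule_ge0.
- exact: emeasurable_funM.
rewrite ge0_integralZr// ge0_integralZl// -/N -/M.
by rewrite mulrC EFinM -muleA mule_natl mule2n.
Qed.

(** As [f] is even, [y] may be replaced by [- y] in the double integral of
    [f(x) f(y) Phi(x + y)]; the average of the two expressions is given by the
    parallelogram law.  The cross terms cancel pointwise, inside that law, so
    that the identity is meaningful for an infinite moment too. *)
Lemma integral_convolution_quadratic f Phi :
  measurable_fun setT f -> measurable_fun setT Phi ->
  (forall x, 0 <= f x) -> (forall x, 0 <= Phi x) ->
  (forall x, f (- x)%R = f x) ->
  (forall x y, Phi (x + y)%R + Phi (x - y)%R = 2%:E * (Phi x + Phi y)) ->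
  \int[leb]_x (convolution f f x * Phi x) =
  2%:E * (\int[leb]_x f x * \int[leb]_x (f x * Phi x)).
Proof.
move=> mf mP f0 P0 fN PD.
set N := \int[leb]_x f x; set M := \int[leb]_x (f x * Phi x).
have N0 : 0 <= N by exact: integral_ge0.
have M0 : 0 <= M by apply: integral_ge0 => x _; exact: mule_ge0.
have mfP : measurable_fun setT (fun x : V => f x * Phi x) by exact: emeasurable_funM.
have fP0 x : 0 <= f x * Phi x by exact: mule_ge0.
have mPD y : measurable_fun setT (fun x : V => Phi (x + y)%R).
  by apply: measurableT_comp => //; exact: measurable_rVD.
pose F y := \int[leb]_x (f x * Phi (x + y)%R).
have F0 y : 0 <= F y by apply: integral_ge0 => x _; exact: mule_ge0.
have mF : measurable_fun setT F.
  apply: (measurable_fun_fubini_tonelli_F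
    (fun z : V * V => f z.2 * Phi (z.2 + z.1)%R)).
    apply: emeasurable_funM; first exact: measurableT_comp.
    by apply: measurableT_comp => //; exact: measurable_rVD.
  by move=> z; exact: mule_ge0.
have FD y : F y + F (- y)%R = 2%:E * (M + N * Phi y).
  rewrite /F -ge0_integralD//; last 4 first.
  - by move=> x _; exact: mule_ge0.
  - exact: emeasurable_funM.
  - by move=> x _; exact: mule_ge0.
  - exact: emeasurable_funM.
  under eq_integral => x _ do rewrite -ge0_muleDr// PD muleCA ge0_muleDr//.
  rewrite ge0_integralZl//; last 2 first.
  - by apply: emeasurable_funD => //; exact: emeasurable_funM.
  - by move=> x _; rewrite adde_ge0// mule_ge0.
  rewrite ge0_integralD//; last 2 first.
  - by move=> x _; exact: mule_ge0.
  - exact: emeasurable_funM.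
  by rewrite ge0_integralZr.
have E : \int[leb]_y (f y * F y) = \int[leb]_y (f y * F (- y)%R).
  rewrite -(ge0_integral_reflect _ 0).
  - by apply: eq_integral => y _; rewrite sub0r fN.
  - exact: emeasurable_funM.
  - by move=> y; exact: mule_ge0.
have -> : \int[leb]_x (convolution f f x * Phi x) = \int[leb]_y (f y * F y).
  exact: integral_convolution.
clearbody F.
have mFN : measurable_fun setT (fun y : V => F (- y)%R).
  by apply: (measurableT_comp mF); exact: measurable_rVN.
have D : 2%:E * \int[leb]_y (f y * F y) = 2%:E * (2%:E * (N * M)).
  transitivity (\int[leb]_y (f y * F y) + \int[leb]_y (f y * F (- y)%R)).
    by rewrite -E -mule2n -mule_natl.
  rewrite -ge0_integralD//;
    last 4 first.
  - by move=> x _; exact: mule_ge0.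
  - exact: emeasurable_funM.
  - by move=> x _; exact: mule_ge0.
  - exact: emeasurable_funM.
  under eq_integral => y _ do
    rewrite -ge0_muleDr// FD muleCA ge0_muleDr// ?mule_ge0// (muleCA (f y) N).
  rewrite ge0_integralZl//; last 2 first.
  - by apply: emeasurable_funD => //; exact: emeasurable_funM.
  - by move=> x _; rewrite adde_ge0// !mule_ge0.
  rewrite ge0_integralD//; last 4 first.
  - by move=> x _; exact: mule_ge0.
  - exact: emeasurable_funM.
  - by move=> x _; rewrite mule_ge0.
  - exact: emeasurable_funM.
  rewrite ge0_integralZr// ge0_integralZl// -/N -/M; congr (_ * _).
  by rewrite mule_natl mule2n.
move: D; move: (\int[leb]_y _) (2%:E * (N * M)) => A B D.
by apply/eqP; rewrite eq_le; apply/andP; split;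
  rewrite -(@lee_pmul2l _ 2%:E)// D.
Qed.

End convolution.

(** * The iterated convolutions of the truncated kernel *)

Section iterates.
Local Open Scope ereal_scope.
Context {R : realType} {d : nat} (nu : 'rV[R]_d -> R).
Local Notation leb := (lebesgue_rV R d).
Local Notation V := 'rV[R]_d.
Hypothesis mnu : measurable_fun setT nu.
Hypothesis nu0 : forall x, (0 <= nu x)%R.

Lemma qiter_ge0 m x : 0 <= qiter nu m x.
Proof.
elim: m x => [|m IH] x /=; last exact: convolution_ge0.
by rewrite lee_fin le_min ler01 nu0.
Qed.

Lemma measurable_qiter m : measurable_fun setT (qiter nu m).
Proof.
elim: m => [|m IH] /=.
  by apply/measurable_EFinP; exact: measurable_minr.
by apply: measurable_convolution => // x; exact: qiter_ge0.
Qed.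

Lemma qiter_even m : (forall x, nu (- x)%R = nu x) ->
  forall x, qiter nu m (- x)%R = qiter nu m x.
Proof.
move=> nuN; elim: m => [|m IH] x /=; first by rewrite nuN.
apply: convolution_even => //; first exact: measurable_qiter.
exact: qiter_ge0.
Qed.

Variable r : R.
Hypothesis rE : \int[leb]_x qiter nu 0 x = r%:E.

Lemma qiter_mass m : \int[leb]_x qiter nu m x = (r ^+ (2 ^ m))%:E.
Proof.
elim: m => [|m IH]; first by rewrite rE expn0 expr1.
rewrite /= convolution_mass ?IH//; try exact: measurable_qiter.
- by rewrite -EFinM -exprD addnn -mul2n expnS.
- exact: qiter_ge0.
- exact: qiter_ge0.
Qed.

Let exp2S m : (2 ^ m.+1 - 1 = 2 ^ m + (2 ^ m - 1))%N.
Proof. by rewrite expnS mul2n -addnn addnBA// expn_gt0. Qed.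

Lemma qiter_subadditive (Phi : V -> \bar R) (K : R) m : (0 <= K)%R ->
  measurable_fun setT Phi -> (forall x, 0 <= Phi x) ->
  (forall x y, Phi (x + y)%R <= K%:E * (Phi x + Phi y)) ->
  \int[leb]_x (qiter nu m x * Phi x) <=
  ((2 * K) ^+ m * r ^+ (2 ^ m - 1))%:E * \int[leb]_x (qiter nu 0 x * Phi x).
Proof.
move=> K0 mP P0 PD; elim: m => [|m IH].
  by rewrite expn0 subnn !expr0 mulr1 mul1e.
apply: le_trans (integral_convolution_subadditive _ _ _ _ _ _ _ _ PD) _ => //.
- exact: measurable_qiter.
- exact: qiter_ge0.
rewrite qiter_mass exp2S muleA -EFinM.
have r0 : (0 <= r)%R.
  by rewrite -lee_fin -rE; apply: integral_ge0 => x _; exact: (qiter_ge0 0).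
apply: (le_trans (lee_wpmul2l _ IH)).
  by rewrite lee_fin !mulr_ge0// exprn_ge0.
rewrite muleA -EFinM exprS exprD.
rewrite le_eqVlt; apply/orP; left; apply/eqP; congr (_%:E * _); ring.
Qed.

Lemma qiter_quadratic (Phi : V -> \bar R) m :
  measurable_fun setT Phi -> (forall x, 0 <= Phi x) ->
  (forall x, nu (- x)%R = nu x) ->
  (forall x y, Phi (x + y)%R + Phi (x - y)%R = 2%:E * (Phi x + Phi y)) ->
  \int[leb]_x (qiter nu m x * Phi x) =
  (2 ^+ m * r ^+ (2 ^ m - 1))%:E * \int[leb]_x (qiter nu 0 x * Phi x).
Proof.
move=> mP P0 nuN PD; elim: m => [|m IH].
  by rewrite expn0 subnn !expr0 mulr1 mul1e.
rewrite [in LHS]/= integral_convolution_quadratic//.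
- rewrite IH qiter_mass exp2S !muleA -!EFinM exprS exprD; congr (_%:E * _); ring.
- exact: measurable_qiter.
- exact: qiter_ge0.
- exact: qiter_even.
Qed.

End iterates.

(** * The increment functional *)

Section increments.
Local Open Scope ereal_scope.
Context {R : realType} {d : nat} (p : R) (u : 'rV[R]_d -> R).
Local Notation leb := (lebesgue_rV R d).
Local Notation V := 'rV[R]_d.

Definition increment (h : V) : \bar R :=
  \int[leb]_x (`|u x - u (x - h)| `^ p)%:E.

Lemma increment_ge0 h : 0 <= increment h.
Proof. by apply: integral_ge0 => x _; rewrite lee_fin powR_ge0. Qed.

Hypothesis mu : measurable_fun setT u.

Lemma measurable_powR_dist disp (T : measurableType disp) (f g : T -> V) :
  measurable_fun setT f -> measurable_fun setT g ->
  measurable_fun setT (fun t => (`|u (f t) - u (g t)| `^ p)%:E).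
Proof.
move=> mf mg; apply/measurable_EFinP.
apply: (measurableT_comp (measurable_powR p)).
apply: measurableT_comp => //; apply: measurable_funB; exact: measurableT_comp.
Qed.

Lemma measurable_increment : measurable_fun setT increment.
Proof.
apply: (measurable_fun_fubini_tonelli_F
  (fun z : V * V => (`|u z.2 - u (z.2 - z.1)| `^ p)%:E)).
  by apply: measurable_powR_dist => //; exact: measurable_rVB.
by move=> z; rewrite lee_fin powR_ge0.
Qed.

Hypothesis p1 : (1 <= p)%R.

(** Convexity of [t |-> t^p] at the midpoint of [2 |a|] and [2 |b|]. *)
Lemma powR_normD (a b : R) :
  (`|a + b| `^ p <= 2 `^ (p - 1) * (`|a| `^ p + `|b| `^ p))%R.
Proof.
have h : (`|2^-1 * (2 * a) + 2^-1 * (2 * b)| `^ p <=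
    2^-1 * `|2 * a| `^ p + 2^-1 * `|2 * b| `^ p)%R.
  apply: (@le_trans _ _ ((2^-1 * `|2 * a| + 2^-1 * `|2 * b|) `^ p)%R).
    apply: ge0_ler_powR; rewrite ?nnegrE//.
    - exact: le_trans p1.
    - apply: (le_trans (ler_normD _ _)).
      by rewrite (normrM _ (2 * a)%R) (normrM _ (2 * b)%R) (@ger0_norm _ 2^-1%R).
  rewrite {2 4}(_ : 2^-1 = 1 - 2^-1)%R; last by rewrite {2}(splitr 1) div1r addrK.
  by apply: (convex_powR p1 (Itv01 _ _)) => //=;
    rewrite ?inE/= ?in_itv/= ?normr_ge0// ?invr_ge0// invf_le1 ?ler1n.
move: h; rewrite !mulrA mulVf// !mul1r !normrM (@ger0_norm _ 2)//.
move=> /le_trans; apply.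
rewrite !powRM// !mulrA -powR_inv1// -powRD ?pnatr_eq0 ?implybT//.
by rewrite (addrC _ p) -mulrDr.
Qed.

(** Go from [x] to [x - a - b] through [x - a]. *)
Lemma incrementD (a b : V) :
  increment (a + b)%R <= (2 `^ (p - 1))%:E * (increment a + increment b).
Proof.
have ma h : measurable_fun setT (fun x : V => (`|u x - u (x - h)| `^ p)%:E).
  by apply: measurable_powR_dist => //; exact: measurable_rVB.
rewrite -[increment b](ge0_integral_translate _ (- a)%R
  (fun x => (`|u x - u (x - b)| `^ p)%:E))//.
have mb : measurable_fun setT
    (fun x : V => (`|u (x - a) - u (x - a - b)| `^ p)%:E).
  by apply: measurable_powR_dist => //; do ?exact: measurable_rVB;
    apply: measurable_rVB => //; exact: measurable_rVB.
rewrite /increment -ge0_integralD//.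
rewrite -ge0_integralZl//; last first.
- by move=> x _; rewrite adde_ge0.
- exact: (emeasurable_funD (ma a) mb).
apply: ge0_le_integral => //.
  by apply: emeasurable_funM => //; exact: (emeasurable_funD (ma a) mb).
move=> x _; rewrite -EFinD -EFinM lee_fin.
by apply: le_trans (powR_normD _ _); rewrite opprD addrA [in leRHS]addrA subrK.
Qed.

End increments.

Section lower_bound.
Local Open Scope ereal_scope.
Context {R : realType} {d : nat} (p : R) (u : 'rV[R]_d -> R).
Local Notation leb := (lebesgue_rV R d).
Local Notation V := 'rV[R]_d.

(** For almost every [x], either [u x = 0], or [x] is in the slab of
    half-width [R0]; then [x - h] is not, so that [u (x - h) = 0]. *)
Lemma increment_far (e : V) (R0 : R) (h : V) : p != 0%R ->
  {ae leb, forall x, ~ slab e R0 x -> u x = 0%R} -> ~ slab e (2 * R0) h ->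
  \int[leb]_x (`|u x| `^ p)%:E <= increment p u h.
Proof.
move=> p0 us hs; apply: ge0_le_integral_ae.
- by move=> x; rewrite lee_fin powR_ge0.
- by move=> x; rewrite lee_fin powR_ge0.
have ush := ae_translate h _ us.
move: us ush; apply: filterS2 => x ux uxh; rewrite lee_fin.
have [xs|/ux ->] := pselect (slab e R0 x); last first.
  by rewrite normr0 powR0// powR_ge0.
rewrite uxh ?subr0// => xhs; apply: hs.
rewrite /slab /= (_ : dotp h e = dotp x e - dotp (x - h) e)%R.
  rewrite (le_trans (ler_normB _ _))// mulr_natl mulr2n.
  exact: lerD.
by rewrite dotpDl dotpNl; ring.
Qed.

Lemma mass_far_le (q : V -> \bar R) (e : V) (R0 : R) : p != 0%R ->
  measurable_fun setT u -> measurable_fun setT q -> (forall x, 0 <= q x) ->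
  {ae leb, forall x, ~ slab e R0 x -> u x = 0%R} ->
  (\int[leb]_(h in ~` slab e (2 * R0)) q h) * \int[leb]_x (`|u x| `^ p)%:E <=
  \int[leb]_h (q h * increment p u h).
Proof.
move=> p0 mu mq q0 us.
have mc : measurable (~` slab e (2 * R0)) by apply: measurableC; exact: measurable_slab.
have farU h := @increment_far e R0 h p0 us.
have mi := measurable_increment p u mu.
have i0 := @increment_ge0 R d p u.
have : 0 <= \int[leb]_x (`|u x| `^ p)%:E.
  by apply: integral_ge0 => x _; rewrite lee_fin powR_ge0.
move: (\int[leb]_x (`|u x| `^ p)%:E) (increment p u) mi i0 farU =>
  U Phi mPhi Phi0 farU U0.
have mqP : measurable_fun setT (fun h => q h * Phi h) by exact: emeasurable_funM.
rewrite -ge0_integralZr//; last exact: measurable_funTS.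
apply: (@le_trans _ _ (\int[leb]_(h in ~` slab e (2 * R0)) (q h * Phi h))).
  apply: ge0_le_integral => //.
  - by move=> x _; exact: mule_ge0.
  - by apply: emeasurable_funM => //; exact: measurable_funTS.
  - exact: measurable_funTS.
  - by move=> h hs; apply: lee_wpmul2l => //; exact: farU.
by apply: ge0_subset_integral => // x _; rewrite mule_ge0.
Qed.

End lower_bound.

Section energy_bound.
Local Open Scope ereal_scope.
Context {R : realType} {d : nat} (p : R).
Local Notation leb := (lebesgue_rV R d).
Local Notation V := 'rV[R]_d.

Lemma integral_increment (q : V -> \bar R) (u : V -> R) :
  measurable_fun setT u -> measurable_fun setT q -> (forall x, 0 <= q x) ->
  \int[leb]_h (q h * increment p u h) =
  \int[leb \x leb]_z (q (z.1 - z.2)%R * (`|u z.1 - u z.2| `^ p)%:E).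
Proof.
move=> mu mq q0.
have w0 (x y : V) : 0 <= (`|u x - u y| `^ p)%:E by rewrite lee_fin powR_ge0.
have mB : measurable_fun setT (fun z : V * V => (z.1 - z.2)%R).
  exact: measurable_rVB.
transitivity (\int[leb]_h \int[leb]_x (q h * (`|u x - u (x - h)| `^ p)%:E)).
  apply: eq_integral => h _; rewrite /increment ge0_integralZl//.
  by apply: measurable_powR_dist => //; exact: measurable_rVB.
rewrite (fubini_tonelli
  (fun z : V * V => q z.1 * (`|u z.2 - u (z.2 - z.1)| `^ p)%:E)); last 2 first.
- apply: emeasurable_funM; first exact: measurableT_comp.
  by apply: measurable_powR_dist => //; exact: measurable_rVB.
- by move=> z; rewrite mule_ge0.
rewrite (fubini_tonelli1
  (fun z : V * V => q (z.1 - z.2)%R * (`|u z.1 - u z.2| `^ p)%:E)); last 2 first.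
- apply: emeasurable_funM; first exact: measurableT_comp.
  exact: measurable_powR_dist.
- by move=> z; rewrite mule_ge0.
apply: eq_integral => x _; rewrite /fubini_F /=.
rewrite -(ge0_integral_reflect _ x
  (fun h => q h * (`|u x - u (x - h)| `^ p)%:E)).
- by apply: eq_integral => y _; rewrite subKr.
- apply: emeasurable_funM => //.
  by apply: measurable_powR_dist => //; exact: measurable_rVB.
- by move=> h; rewrite mule_ge0.
Qed.

(** The left-hand side is the double integral over all pairs of the Borel
    representatives; on pairs of points outside [Omega] it vanishes almost
    everywhere, so that integrating over the complement of these pairs, as the
    energy does, loses nothing. *)
Lemma integral_increment_le_energy (nu nu' u u' : V -> R) (Omega : set V) :
  p != 0%R -> (forall h, h != 0 -> 0 <= nu h)%R ->
  (forall h, 0 <= nu' h)%R ->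
  measurable_fun setT nu' -> measurable_fun setT u' ->
  {ae leb, forall h, nu h = nu' h} -> {ae leb, forall x, u x = u' x} ->
  {ae leb, forall x, (~` Omega) x -> u x = 0%R} ->
  \int[leb]_h (qiter nu' 0 h * increment p u' h) <= energy p nu Omega u.
Proof.
move=> p0 nu0 nu'0 mnu' mu' nuE uE uO.
rewrite integral_increment//; last 2 first.
- exact: measurable_qiter.
- exact: qiter_ge0.
rewrite /energy [leRHS]integral_mkcond; apply: ge0_le_integral_ae.
- by move=> z; rewrite mule_ge0 ?qiter_ge0// lee_fin powR_ge0.
- apply: erestrict_ge0 => z _; rewrite lee_fin.
  (* [nu] may be negative at the origin, where the difference of [u] is 0. *)
  have [->|zz] := eqVneq z.1 z.2; first by rewrite subrr normr0 powR0// mul0r.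
  by rewrite mulr_ge0 ?powR_ge0// nu0// subr_eq0.
have n3 := ae_prod_sub _ nuE.
have u1 := ae_prod_fst _ uE; have u2 := ae_prod_snd _ uE.
have o1 := ae_prod_fst _ uO; have o2 := ae_prod_snd _ uO.
near=> z; rewrite patchE.
have nz : nu (z.1 - z.2)%R = nu' (z.1 - z.2)%R by near: z.
have uz1 : u z.1 = u' z.1 by near: z.
have uz2 : u z.2 = u' z.2 by near: z.
have oz1 : (~` Omega) z.1 -> u z.1 = 0%R by near: z.
have oz2 : (~` Omega) z.2 -> u z.2 = 0%R by near: z.
rewrite -uz1 -uz2; case: ifPn => [_|].
  rewrite /= nz -EFinM lee_fin mulrC ler_wpM2l ?powR_ge0//.
  by rewrite ge_min lexx orbT.
rewrite notin_setE /= => /contrapT [/oz1 -> /oz2 ->].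
by rewrite subrr normr0 powR0// mule0.
Unshelve. all: by end_near. Qed.

End energy_bound.

(** * Mass of the iterated kernel far from a hyperplane *)

Section positivity.
Local Open Scope ereal_scope.
Context {R : realType} {d : nat} (nu : 'rV[R]_d -> R).
Local Notation leb := (lebesgue_rV R d).
Local Notation V := 'rV[R]_d.
Hypothesis mnu : measurable_fun setT nu.
Hypothesis nu0 : forall x, (0 <= nu x)%R.
Hypothesis nu_neq0 : ~ leb.-negligible [set h | (0 < nu h)%R].

Lemma qiter0_weight_gt0 (w : V -> \bar R) : measurable_fun setT w ->
  (forall x, 0 <= w x) -> {ae leb, forall x, w x != 0} ->
  0 < \int[leb]_x (qiter nu 0 x * w x).
Proof.
move=> mw w0 wE.
have q0 := @qiter_ge0 R d nu nu0 0.
have mq := @measurable_qiter R d nu mnu nu0 0.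
have qw0 x : 0 <= qiter nu 0 x * w x by exact: mule_ge0.
rewrite lt_neqAle integral_ge0 ?andbT//; apply/eqP => /esym I0.
apply: nu_neq0.
have mqw : measurable_fun setT (fun x => qiter nu 0 x * w x).
  exact: emeasurable_funM.
have : \int[leb]_x `|qiter nu 0 x * w x| = 0.
  by rewrite -[RHS]I0; apply: eq_integral => x _; rewrite gee0_abs.
move=> /(ae_eq_integral_abs leb measurableT mqw) qwE.
suff [N [mN N0 NP]] : {ae leb, forall x, nu x = 0%R}.
  exists N; split => // x /= nux; apply: NP => /= nux0.
  by rewrite nux0 ltxx in nux.
move: wE qwE; apply: filterS2 => x wx /(_ I) /eqP.
rewrite /= mule_eq0 (negbTE wx) orbF => /eqP[].
by rewrite /Num.min; case: ifP => // _ /eqP; rewrite oner_eq0.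
Qed.

Variable r : R.
Hypothesis rE : \int[leb]_x qiter nu 0 x = r%:E.

Lemma qiter0_mass_gt0 : (0 < r)%R.
Proof.
rewrite -lte_fin -rE; have := @qiter0_weight_gt0 (cst 1).
under eq_integral do rewrite mule1.
by apply=> //; apply: aeW => x; rewrite onee_eq0.
Qed.

(** If [qiter nu m] vanished outside the slab, its second moment in the
    direction [e], which is [2 ^ m * r ^ (2 ^ m - 1)] times that of
    [qiter nu 0], would be at most [L ^ 2] times its mass [r ^ (2 ^ m)]. *)
Lemma qiter_far_gt0 (e : V) (L : R) : dotp e e = 1%R ->
  (forall x, nu (- x)%R = nu x) ->
  exists m0 : nat, forall m, (m0 <= m)%N ->
    0 < \int[leb]_(h in ~` slab e L) qiter nu m h.
Proof.
move=> ee nuN; pose w (x : V) := ((dotp x e) ^+ 2)%:E.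
have mw : measurable_fun setT w.
  apply/measurable_EFinP; apply: measurable_funX; exact: measurable_dotp.
have w0 x : 0 <= w x by rewrite lee_fin sqr_ge0.
have wE : {ae leb, forall x, w x != 0}.
  by move: (ae_dotp_neq0 e ee); apply: filterS => x xe; rewrite eqe sqrf_eq0.
have r0 := qiter0_mass_gt0.
have M0 := qiter0_weight_gt0 _ mw w0 wE.
(* The second moment of [qiter nu 0] may be infinite: keep a real [c] below. *)
have [c c0 cM] : exists2 c : R, (0 < c)%R & c%:E <= \int[leb]_x (qiter nu 0 x * w x).
  case: (\int[leb]_x _) M0 => [c||//]; last by exists 1%R; rewrite ?leey.
  by rewrite lte_fin => c0; exists c.
have wD x y : w (x + y)%R + w (x - y)%R = 2%:E * (w x + w y).
  rewrite /w !dotpDl dotpNl -!EFinD -EFinM; congr EFin; ring.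
have [m0 m0P] : exists m0 : nat, (L ^+ 2 * r < c * m0%:R)%R.
  exists (Num.truncn (L ^+ 2 * r / c)).+1.
  by rewrite (mulrC c) -ltr_pdivrMr// truncnS_gt.
exists m0 => m m0m.
have qm0 := @qiter_ge0 R d nu nu0 m.
have mqm := @measurable_qiter R d nu mnu nu0 m.
rewrite lt_neqAle integral_ge0 ?andbT//; apply/eqP => /esym I0.
have mc : measurable (~` slab e L) by apply: measurableC; exact: measurable_slab.
have qE : {ae leb, forall x, (~` slab e L) x -> qiter nu m x = 0}.
  apply/(ae_eq_integral_abs leb mc); first exact: measurable_funTS.
  by rewrite -[RHS]I0; apply: eq_integral => x _; rewrite gee0_abs.
have : \int[leb]_x (qiter nu m x * w x) <=
       \int[leb]_x ((L ^+ 2)%:E * qiter nu m x).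
  apply: ge0_le_integral_ae.
  - by move=> x; rewrite mule_ge0.
  - by move=> x; rewrite mule_ge0// lee_fin sqr_ge0.
  move: qE; apply: filterS => x qx.
  have [xs|/qx ->] := pselect (slab e L x); last by rewrite mul0e mule0.
  rewrite muleC; apply: lee_wpmul2r => //; rewrite lee_fin.
  by rewrite -real_normK ?num_real// lerXn2r// nnegrE (le_trans _ xs).
rewrite ge0_integralZl// ?lee_fin ?sqr_ge0//.
rewrite (qiter_mass nu mnu nu0 r rE) (qiter_quadratic nu mnu nu0 r rE w m)//.
move=> H.
have : (2 ^+ m * r ^+ (2 ^ m - 1))%:E * c%:E <= (L ^+ 2)%:E * (r ^+ (2 ^ m))%:E.
  apply: le_trans H; apply: lee_wpmul2l => //.
  by rewrite lee_fin mulr_ge0 ?exprn_ge0// ltW.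
rewrite -!EFinM lee_fin.
have k2 : (2 ^ m = (2 ^ m - 1).+1)%N by rewrite subn1 prednK// expn_gt0.
rewrite [X in (_ <= _ * r ^+ X)%R]k2 (mulrAC (2 ^+ m)%R) (exprSr r) (mulrC (r ^+ _)%R r) (mulrA (L ^+ 2)%R).
rewrite ler_pM2r ?exprn_gt0//; apply/negP; rewrite -ltNge.
apply: (lt_le_trans m0P); rewrite mulrC.
apply: ler_wpM2r; first exact: ltW.
by rewrite -natrX ler_nat (leq_trans m0m)// ltnW// ltn_expl.
Qed.

End positivity.

(** * Reduction to an even Borel kernel *)

Section ae_iterates.
Local Open Scope ereal_scope.
Context {R : realType} {d : nat}.
Local Notation leb := (lebesgue_rV R d).
Local Notation V := 'rV[R]_d.

Lemma convolution_ae (f f' g g' : V -> \bar R) :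
  {ae leb, forall x, f x = f' x} -> {ae leb, forall x, g x = g' x} ->
  forall x, convolution f g x = convolution f' g' x.
Proof.
move=> ff gg x; apply: eq_integral_ae.
move: (ae_reflect x _ ff) gg; apply: filterS2 => y fy gy.
by rewrite fy gy.
Qed.

Lemma qiter_ae (nu nu' : V -> R) m : {ae leb, forall x, nu x = nu' x} ->
  {ae leb, forall x, qiter nu m x = qiter nu' m x}.
Proof.
move=> nuE; elim: m => [|m IH] /=.
  by apply: filterS nuE => x ->.
by apply: aeW => x; exact: convolution_ae.
Qed.

Lemma dotp_ge0 (x : V) : (0 <= dotp x x)%R.
Proof. by apply: sumr_ge0 => i _; rewrite -expr2 sqr_ge0. Qed.

Lemma eball_box : eball 1%R `<=` @box R d (const_mx (- 1)%R) (const_mx 1%R).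
Proof.
move=> x; rewrite /eball /enorm /box /= => x1 i; rewrite !mxE -ler_norml.
have xi : (`|x ord0 i| ^+ 2 <= dotp x x)%R.
  rewrite real_normK ?num_real// /dotp (bigD1 i)//= -expr2 lerDl.
  by apply: sumr_ge0 => j _; rewrite -expr2 sqr_ge0.
rewrite -(@ler_sqr _ _ 1%R) ?nnegrE// expr1n (le_trans xi)//.
rewrite -(sqr_sqrtr (dotp_ge0 x)) expr_le1 ?sqrtr_ge0//.
exact: ltW.
Qed.

(** Bound the truncated kernel by 1 on the cube, and by the kernel itself
    outside the cube, hence outside the unit ball. *)
Lemma qiter0_mass_lty (nu nu' : V -> R) : measurable_fun setT nu' ->
  (forall x, 0 <= nu' x)%R -> {ae leb, forall x, nu x = nu' x} ->
  in_Lp 1 (~` eball 1) nu -> \int[leb]_x qiter nu' 0 x < +oo.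
Proof.
move=> mnu nu0 nuE [_]; rewrite /Lp_norm Lnorm1.
pose B := @box R d (const_mx (- 1)%R) (const_mx 1%R).
have mB : measurable B by exact: measurable_box.
have mBC : measurable (~` B) by exact: measurableC.
pose t := (EFin \o nu') \_ (~` B).
have t0 x : 0 <= t x by apply: erestrict_ge0 => y _; rewrite lee_fin.
have mt : measurable_fun setT t.
  by apply/(measurable_restrictT _ _).1 => //; apply: measurable_funTS;
    exact/measurable_EFinP.
move=> nuoo.
apply: (@le_lt_trans _ _ (\int[leb]_x ((\1_B x)%:E + t x))).
  apply: ge0_le_integral => //.
  - by move=> x _; exact: qiter_ge0.
  - exact: (measurable_qiter nu' mnu nu0 0).
  - by apply: emeasurable_funD => //; exact/measurable_EFinP.
  - move=> x _; rewrite /t patchE indicE /=.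
    have [xB|xB] := boolP (x \in B).
      rewrite ifN; last by rewrite notin_setE /= => /(_ (set_mem xB)).
      by rewrite adde0 lee_fin ge_min lexx.
    rewrite ifT; last by rewrite inE /= => /mem_set; rewrite (negbTE xB).
    by rewrite add0e lee_fin ge_min lexx orbT.
rewrite ge0_integralD//; last exact/measurable_EFinP.
have Boo : leb B < +oo.
  by rewrite lebesgue_rV_box ?ltry// => i; rewrite !mxE; lra.
apply: lte_add_pinfty; first by rewrite integral_indic// setIT.
apply: le_lt_trans nuoo; apply: ge0_le_integral_ae => //.
apply: filterS nuE => x nux; rewrite /t /= !patchE.
case: ifPn => [|_]; last by rewrite lee_fin.
rewrite inE /= => xB; rewrite ifT; last by rewrite inE => /eball_box.
by rewrite nux lee_fin ler_norm.
Qed.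

(** Starting from a Borel representative [g], the minimum of [g] and its
    reflection makes it even, and the maximum with 0 makes it nonnegative
    everywhere; off the origin [nu] already has both properties. *)
Lemma even_borel_representative (nu : V -> R) :
  {ae leb, forall h, h != 0%R} -> lebesgue_measurable nu ->
  (forall h, h != 0%R -> 0 <= nu h)%R ->
  (forall h, h != 0%R -> nu h = nu (- h))%R ->
  exists nu' : V -> R, [/\ measurable_fun setT nu', (forall h, 0 <= nu' h)%R,
    (forall h, nu' (- h) = nu' h)%R & {ae leb, forall h, nu h = nu' h}].
Proof.
move=> ae0 [g mg nug] nu0 nuN.
exists (fun h => Num.max 0 (Num.min (g h) (g (- h))))%R; split.
- apply: measurable_maxr => //; apply: measurable_minr => //.
  by apply: measurableT_comp => //; exact: measurable_rVN.
- by move=> h; rewrite le_max lexx.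
- by move=> h; rewrite opprK minC.
- move: ae0 nug (ae_opp _ nug); apply: filterS3 => h h0 gh gNh.
  by rewrite -gh -gNh -(nuN h h0) minxx max_r// nu0.
Qed.

End ae_iterates.

(* [nu] is a function on R^d minus the origin: its value at 0 is unconstrained.
   The assumption |e| = 1 forces 0 < d. *)
Theorem theorem7p2 (R : realType) (d : nat) (p : R) (p_ge1 : 1 <= p)
  (nu : 'rV[R]_d -> R)
  (nu_meas : lebesgue_measurable nu)
  (nu_ge0 : forall h, h != 0 -> 0 <= nu h)
  (nu_sym : forall h, h != 0 -> nu h = nu (- h))
  (nu_L1 : forall r : R, 0 < r -> in_Lp 1 (~` eball r) nu)
  (nu_neq0 : ~ (lebesgue_rV R d).-negligible [set h | h != 0 /\ 0 < nu h])
  (R0 : R) (R0_gt0 : 0 < R0)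
  (e : 'rV[R]_d) (e_unit : enorm e = 1) :
  exists m0 : nat, forall m : nat, (m0 <= m)%N ->
    exists C : R,
      [/\ 0 < C,
          (C%:E = (2 `^ (p * m%:R))%:E
                  * 'N[lebesgue_rV R d]_1[qiter nu 0] ^+ (2 ^ m - 1)%N
                  * (\int[lebesgue_rV R d]_(h in ~` slab e (2 * R0))
                       qiter nu m h)^-1)%E
        & forall Omega : set 'rV[R]_d, open Omega -> Omega `<=` slab e R0 ->
          forall u : 'rV[R]_d -> R, in_Lp_Omega p Omega u ->
            (Lp_norm p Omega u `^ p <= C%:E * energy p nu Omega u)%E].
Proof.
have p0 : p != 0%R by rewrite gt_eqF// (lt_le_trans _ p_ge1).
have ee : dotp e e = 1%R.
  by rewrite -(sqr_sqrtr (dotp_ge0 e)) -/(enorm e) e_unit expr1n.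
have ae0 := ae_neq0 _ ee.
have [nu' [mnu nu0 nuN nuE]] := even_borel_representative _ ae0 nu_meas nu_ge0 nu_sym.
set leb := lebesgue_rV R d in nu_neq0 ae0 nuE *.
have nu'_neq0 : ~ leb.-negligible [set h | (0 < nu' h)%R].
  move=> nu'0; apply: nu_neq0.
  have [N [mN N0 NE]] := nuE.
  apply: (@negligibleS _ _ _ _ ([set h | (0 < nu' h)%R] `|` N)).
    move=> h /= [_ nuh]; have [Nh|Nh] := pselect (N h); [by right|left].
    rewrite -(_ : nu h = nu' h)//; apply: contrapT => nuh'.
    by apply: Nh; exact: NE.
  by apply: negligibleU => //; exact/negligibleP.
have q0 m x := @qiter_ge0 R d nu' nu0 m x.
have mq m := @measurable_qiter R d nu' mnu nu0 m.
have massoo := qiter0_mass_lty _ _ mnu nu0 nuE (nu_L1 _ ltr01).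
have [r rE] : exists r : R, (\int[leb]_x qiter nu' 0 x = r%:E)%E.
  exists (fine (\int[leb]_x qiter nu' 0 x)%E); rewrite fineK// ge0_fin_numE//.
  exact: integral_ge0.
have r0 := qiter0_mass_gt0 _ mnu nu0 nu'_neq0 _ rE.
have [m0 m0P] := qiter_far_gt0 _ mnu nu0 nu'_neq0 _ rE _ (2 * R0)%R ee nuN.
exists m0 => m m0m; have I0 := m0P m m0m.
have IE : (\int[leb]_(h in ~` slab e (2 * R0)) qiter nu m h =
    \int[leb]_(h in ~` slab e (2 * R0)) qiter nu' m h)%E.
  rewrite integral_mkcond [RHS]integral_mkcond; apply: eq_integral_ae.
  by apply: filterS (qiter_ae _ _ m nuE) => x qx; rewrite !patchE qx.
have NE : ('N[leb]_1[qiter nu 0] = r%:E)%E.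
  rewrite Lnorm1 -rE; apply: eq_integral_ae.
  by apply: filterS (qiter_ae _ _ 0 nuE) => x ->; rewrite gee0_abs.
have Ioo : (\int[leb]_(h in ~` slab e (2 * R0)) qiter nu' m h < +oo)%E.
  apply: (@le_lt_trans _ _ (\int[leb]_h qiter nu' m h)%E).
    apply: ge0_subset_integral => //.
    by apply: measurableC; exact: measurable_slab.
  by rewrite (qiter_mass _ mnu nu0 _ rE) ltry.
have [I IIE] : exists I : R,
    (\int[leb]_(h in ~` slab e (2 * R0)) qiter nu' m h = I%:E)%E.
  exists (fine (\int[leb]_(h in ~` slab e (2 * R0)) qiter nu' m h)%E).
  by rewrite fineK// ge0_fin_numE// ltW.
have {}I0 : (0 < I)%R by rewrite -lte_fin -IIE.
pose A := (2 `^ (p * m%:R) * r ^+ (2 ^ m - 1))%R.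
have A0 : (0 < A)%R by rewrite mulr_gt0 ?powR_gt0 ?exprn_gt0.
exists (A / I)%R; split; first by rewrite divr_gt0.
  by rewrite IE NE IIE -EFin_expe inver gt_eqF// -!EFinM.
move=> Omega _ Om u [[[u' mu' uE'] _] uO].
have {uE'} uE : {ae leb, forall x, u x = u' x}.
  by apply: filterS uE' => x; rewrite patch_setT.
have uS : {ae leb, forall x, ~ slab e R0 x -> u' x = 0%R}.
  move: uE uO; apply: filterS2 => x <- ux xs; apply: ux => Ox.
  exact/xs/Om.
have -> : (Lp_norm p Omega u `^ p = \int[leb]_x (`|u' x| `^ p)%:E)%E.
  rewrite /Lp_norm (poweR_Lnorm _ _ p0); apply: eq_integral_ae.
  move: uE uO; apply: filterS2 => x <- ux /=; rewrite patchE.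
  case: ifPn => // ; rewrite notin_setE => /ux ->; by rewrite normr0.
have H1 := mass_far_le _ _ _ _ _ p0 mu' (mq m) (q0 m) uS.
have H2 : (\int[leb]_h (qiter nu' m h * increment p u' h) <=
    A%:E * \int[leb]_h (qiter nu' 0 h * increment p u' h))%E.
  have := qiter_subadditive _ mnu nu0 _ rE _ _ m (powR_ge0 2 (p - 1))
    (measurable_increment p _ mu') (@increment_ge0 R d p u')
    (incrementD _ _ mu' p_ge1).
  have -> : (2 * 2 `^ (p - 1) = 2 `^ p :> R)%R.
    by rewrite -{1}(powRr1 (ler0n R 2)) -powRD ?subrKC// pnatr_eq0 implybT.
  by rewrite -powR_mulrn ?powR_ge0// -powRrM.
have H3 := integral_increment_le_energy _ _ _ _ _ _ p0 nu_ge0 nu0 mnu mu' nuE uE uO.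
rewrite IIE in H1.
(* [I |u|^p <= int q_m Phi_u <= A int q Phi_u <= A E(u,u)] *)
have {}H1 := le_trans H1 (le_trans H2 (lee_wpmul2l _ H3)).
rewrite mulrC EFinM -muleA lee_pdivlMl//.
by apply: H1; rewrite lee_fin ltW.
Qed.
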